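(* For positive integers $k$ and $r$ with $k>r$, \[ \sum_{\substack{k_1+\cdots+k_r=k\\ k_1,\ldots,k_{r-1}\ge 1,\ k_r\ge 2}}\zeta^Q_{(r)}(k_1,\ldots,k_r)=\sum_{i=1}^r 2^i\binom{k-i-1}{r-i}\zeta(k) \] and \[ \sum_{\substack{k_1+\cdots+k_r=k\\ k_1,\ldots,k_{r-1}\ge 1,\ k_r\ge 2}}\zeta^P_{(r)}(k_1,\ldots,k_r)=\sum_{i=1}^r 2^{i-1}\binom{k-i-1}{r-i}\zeta(k), \] where the sums are over integers $k_1,\ldots,k_r$.
   Context: Let $\mathbb N'=\{1',1,2',2,\ldots\}$ with total order $1'<1<2'<2<\cdots$, and put $|i|=|i'|=i$. For the one-row shape $(r)$, $\zeta^Q_{(r)}(k_1,\ldots,k_r)=\sum\prod_{j=1}^r |m_j|^{-k_j}$, the sum being over all sequences $m_1\le m_2\le\cdots\le m_r$ in $\mathbb N'$ such that for each $i\ge1$ the letter $i'$ occurs at most once; $\zeta^P_{(r)}(k_1,\ldots,k_r)$ is the same sum restricted to sequences with $m_1$ unprimed. (These are the Schur $Q$- and Schur $P$-multiple zeta functions of the one-row shifted shape $(r)$ with row entries $k_1,\ldots,k_r$.) $\zeta(k)=\sum_{m\ge1}m^{-k}$. *)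

(* Defs.v *)
From mathcomp Require Import all_boot all_order all_algebra.
From mathcomp Require Import all_classical all_reals all_analysis.

Set Implicit Arguments.
Unset Strict Implicit.
Unset Printing Implicit Defensive.

Import Order.TTheory GRing.Theory Num.Theory.
Import numFieldNormedType.Exports.

Local Open Scope classical_set_scope.
Local Open Scope ring_scope.

(* A letter is a pair ordered lexicographically: i' is (i, false) and i is
   (i, true), so that i' < i < (i+1)'. The alphabet N' consists of the letters
   of positive absolute value; (0, _) is not in N' and is excluded in [Qword]. *)
Definition letter := (nat *l bool)%type.

Definition absl (a : letter) : nat := a.1.

Definition primed (i : nat) : letter := (i, false).

Definition unprimed (i : nat) : letter := (i, true).

Definition Qword (r : nat) : set (r.-tuple letter) :=
  [set m | [/\ forall j : 'I_r, (0 < absl (tnth m j))%N,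
               sorted <=%O m
             & forall i : nat, (count_mem (primed i) m <= 1)%N]].

Definition Pword (r : nat) : set (r.-tuple letter) :=
  [set m | Qword m /\
           forall j : 'I_r, j = 0%N :> nat ->
             tnth m j = unprimed (absl (tnth m j))].

(* The terms are nonnegative, so the unordered sums are taken in the extended
   reals, where [+oo] stands for divergence. *)
Definition zetaQ (R : realType) (r : nat) (k : 'I_r -> nat) : \bar R :=
  \esum_(m in @Qword r) (\prod_(j < r) (absl (tnth m j))%:R ^- k j)%:E.

Definition zetaP (R : realType) (r : nat) (k : 'I_r -> nat) : \bar R :=
  \esum_(m in @Pword r) (\prod_(j < r) (absl (tnth m j))%:R ^- k j)%:E.

Definition zeta (R : realType) (k : nat) : R :=
  limn (series (fun n : nat => n.+1%:R ^- k : R)).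

(* Since the parts are nonnegative with sum k, letting them range over
   'I_k.+1 is no restriction. *)
Definition admissible (k r : nat) (ks : {ffun 'I_r -> 'I_k.+1}) : bool :=
  (\sum_(j < r) ks j == k)%N &&
  [forall j : 'I_r, if j.+1 == r then (2 <= ks j)%N else (1 <= ks j)%N].

(* Main.v *)
Require Import Defs.
From mathcomp Require Import all_boot all_order all_algebra.
From mathcomp Require Import all_classical all_reals all_analysis.
From mathcomp Require Import ring lra zify.

(** In a word of the one-row Q-sum the letters of absolute value [m] form a
    block, and only the first letter of a block may be primed. A weakly
    increasing sequence of absolute values with [d] distinct values therefore
    carries [2 ^ d] words for Q, and half as many for P, where the first letter
    is unprimed. Summing over all exponents, one merges each block of equal
    values into a single letter whose exponent is the sum of the exponents of
    the block: [l_1 + ... + l_d = k] with [l_d >= 2] then arises in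
    [sum_(b_1 + ... + b_d = r) 'C(l_1 - 1, b_1 - 1) ... 'C(l_d - 2, b_d - 1)]
    ways, which is ['C(k - d - 1, r - d)] by Vandermonde, whatever the [l_j]
    are. Hence the Q-sum is [sum_d 2 ^ d 'C(k - d - 1, r - d) S(k, d)] with
    [S(k, d)] the sum of all convergent multiple zeta values of weight [k] and
    depth [d], and the classical sum formula [S(k, d) = zeta(k)] concludes.

    The merging is never carried out as a bijection. The exponents are encoded
    by coefficients of polynomials ([sum_admissible]), the words are listed by
    the absolute value of their last letter ([words]), and both sides of the
    merging identity satisfy the same two-term recursion in the weight
    ([merged_sum_rec], [coef_sum_word_poly]), by Pascal's rule.

    The sum formula is proved by connected sums. For fixed [0 < x < 1] the
    generating function of [S(k, d)] in [x ^ (k - d - 1)] is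
    [sum_(0 < m_1 < ... < m_d) m_d^-1 / ((m_1 - x) ... (m_d - x))].
    With the connector [C(m, n) = D(m) D(n) / D(m + n)], where
    [D(n) = (1 - x) ... (n - x)], the telescoping identity
    [sum_(a > m) C(a, n) / (a - x) = C(m, n) / n] ([sum_connector]) first turns
    [m_d^-1] into [sum_(n > 0) C(m_d, n) / (n - x)] and then removes
    [m_d], ..., [m_1] one after the other, each leaving a factor [n^-1]. What
    remains is [sum_n n ^ - d / (n - x)], the generating function of the
    [zeta(k)]. All terms are nonnegative, so the interchanges of summation are
    free, and the coefficients are compared at the end
    ([power_series_inj]). *)

Set Implicit Arguments.
Unset Strict Implicit.
Unset Printing Implicit Defensive.

Import Order.TTheory GRing.Theory Num.Theory.
Import numFieldNormedType.Exports.

Local Open Scope classical_set_scope.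
Local Open Scope ring_scope.

(** * Uniqueness of power series coefficients *)

Lemma eseries_EFin_cvg (R : realType) (f : nat -> R) (l : R) :
  series f @ \oo --> l -> (\sum_(n <oo) (f n)%:E = l%:E)%E.
Proof.
move=> fl; apply/cvg_lim => //.
rewrite (_ : (fun n => _) = EFin \o series f); last first.
  by apply/funext => n; rewrite /series /= sumEFin.
by apply: cvg_EFin fl; apply: nearW.
Qed.

(** If [n] is the first index with [u n != 0], the tail after [n] is
    [O(x ^ n.+1)] by the geometric bound on [u], so [`|u n|] is [O(x)] for
    small [x]. *)
Lemma power_series_eq0 (R : realType) (u : nat -> R) (K : R) :
  (forall n, `|u n| <= K * 2 ^+ n) ->
  (forall x : R, 0 < x < 1 -> series (fun n => u n * x ^+ n) @ \oo --> (0 : R)) ->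
  forall n, u n = 0.
Proof.
move=> uK u0; elim/ltn_ind => n IH.
have K0 : 0 <= K by have := uK 0%N; rewrite expr0 mulr1; apply: le_trans.
(* [x <= 1 / 4] makes the ratio [2 * x] of the majorant at most [1 / 2]. *)
have tail (x : R) N : 0 < x <= 4^-1 ->
    `|u n| * x ^+ n <= `|\sum_(0 <= i < n.+1 + N) u i * x ^+ i| + 2 * K * (2 * x) ^+ n.+1.
  move=> /andP[x0 x4].
  have x2 : 2 * x <= 2^-1 by lra.
  have x20 : 0 < 2 * x by lra.
  rewrite (@big_cat_nat _ _ _ n.+1) ?leq_addr//= big_nat_recr//= big_nat big1 ?add0r;
    last first.
    by move=> i /andP[_ /IH ->]; rewrite mul0r.
  set t := \sum_(_ <= i < _) _.
  have tK : `|t| <= 2 * K * (2 * x) ^+ n.+1.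
    have geo p : \sum_(0 <= i < p) (2 * x) ^+ i <= 2 - 2^-1 ^+ p *+ 2.
      elim: p => [|p IHp]; first by rewrite big_geq// expr0; lra.
      rewrite big_nat_recr//=.
      have : (2 * x) ^+ p <= 2^-1 ^+ p by rewrite lerXn2r ?nnegrE//; lra.
      by rewrite exprS; lra.
    rewrite /t -{1}[n.+1]add0n big_addn addKn.
    apply: le_trans (ler_norm_sum _ _ _) _.
    apply: (@le_trans _ _ (\sum_(0 <= i < N) K * (2 * x) ^+ n.+1 * (2 * x) ^+ i)).
      apply: ler_sum => i _; rewrite normrM [`|x ^+ _|]ger0_norm ?exprn_ge0//; last exact: ltW.
      rewrite -mulrA -exprD addnC exprMn mulrA ler_wpM2r ?exprn_ge0//; exact: ltW.
    rewrite -mulr_sumr -[leRHS]mulrA [leLHS]mulrC.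
    rewrite ler_wpM2r// ?mulr_ge0 ?exprn_ge0//; first exact: ltW.
    have : 0 <= 2^-1 ^+ N :> R by rewrite exprn_ge0.
    by have := geo N; lra.
  rewrite -[x in _ * x]ger0_norm ?exprn_ge0 -?normrM//; last exact: ltW.
  rewrite -{1}[u n * _](addrK t); apply: le_trans (ler_normB _ _) _.
  by rewrite lerD2l.
have lim (x : R) : 0 < x <= 4^-1 -> `|u n| <= 2 * K * 2 ^+ n.+1 * x.
  move=> x4; have [x0 x14] := andP x4.
  have x1 : 0 < x < 1 by lra.
  have xn : 0 < x ^+ n by rewrite exprn_gt0.
  rewrite -(ler_pM2r xn).
  have -> : 2 * K * 2 ^+ n.+1 * x * x ^+ n = 2 * K * (2 * x) ^+ n.+1.
    by rewrite exprMn [x ^+ n.+1]exprS; ring.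
  have := u0 _ x1; rewrite -(cvg_shiftn n.+1) => /cvg_norm; rewrite normr0 => c.
  have {}c : (fun N => `|series (fun n => u n * x ^+ n) (N + n.+1)%N|
      + 2 * K * (2 * x) ^+ n.+1) @ \oo --> 2 * K * (2 * x) ^+ n.+1.
    rewrite -[X in _ --> X]add0r; apply: cvgD c _; exact: cvg_cst.
  rewrite -(cvg_lim _ c)//; apply: limr_ge; first by apply: cvgP c.
  by apply: nearW => N /=; rewrite addnC; exact: tail.
apply/eqP; rewrite -normr_eq0 eq_le normr_ge0 andbT.
apply/ler_addgt0Pl => e e0; rewrite addr0.
set B := 2 * K * 2 ^+ n.+1 in lim.
have B0 : 0 <= B by rewrite !mulr_ge0 ?exprn_ge0.
pose x := Num.min 4^-1 (e / (B + 1)).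
have B1 : 0 < B + 1 by lra.
have x4 : 0 < x <= 4^-1 by rewrite /x lt_min ge_min lexx/= divr_gt0//; lra.
apply: le_trans (lim _ x4) _.
apply: (@le_trans _ _ (B * (e / (B + 1)))); first by rewrite ler_wpM2l// /x ge_min lexx orbT.
rewrite mulrCA ler_piMr//; first exact: ltW.
by rewrite ler_pdivrMr//; lra.
Qed.

Lemma nneseries_EFin_cvg (R : realType) (f : nat -> R) (l : R) :
  (forall n, 0 <= f n) -> (\sum_(n <oo) (f n)%:E = l%:E)%E ->
  series f @ \oo --> l.
Proof.
move=> f0 fl; have /cvg_ex[/= l' fl'] : cvgn (series f).
  by apply: nnseries_is_cvg; rewrite // fl ltry.
by have := eseries_EFin_cvg fl'; rewrite fl => -[->].
Qed.

(** The bound on [b] makes the second series finite, hence also the first; its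
    value at [x = 1 / 2] bounds [a n] by a multiple of [2 ^+ n], and
    [power_series_eq0] applies to the difference. *)
Lemma power_series_inj (R : realType) (a b : nat -> \bar R) (B : R) :
  (forall n, 0 <= a n)%E -> (forall n, 0 <= b n <= B%:E)%E ->
  (forall x : R, (0 < x < 1)%R ->
    \sum_(n <oo) (x ^+ n)%R%:E * a n = \sum_(n <oo) (x ^+ n)%R%:E * b n)%E ->
  a =1 b.
Proof.
move=> a0 bB ab.
have b0 n : (0 <= b n)%E by case/andP: (bB n).
have bfin n : b n \is a fin_num.
  by rewrite ge0_fin_numE//; case/andP: (bB n) => _ /le_lt_trans; apply; exact: ltry.
have B0 : 0 <= B by rewrite -lee_fin; case/andP: (bB 0%N); exact: le_trans.
have bser (x : R) : 0 < x < 1 -> (\sum_(n <oo) (x ^+ n)%R%:E * b n <= (B / (1 - x))%R%:E)%E.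
  move=> /andP[x0 x1].
  have <- : (\sum_(n <oo) (geometric B x n)%:E = (B / (1 - x))%R%:E)%E.
    by apply/eseries_EFin_cvg/cvg_geometric_series; rewrite ger0_norm// ltW.
  apply: lee_nneseries => n *; first by rewrite mule_ge0// lee_fin exprn_ge0// ltW.
  rewrite /= mulrC EFinM lee_wpmul2l ?lee_fin ?exprn_ge0//; last by case/andP: (bB n).
  exact: ltW.
have xa0 (x : R) n : 0 < x < 1 -> (0 <= (x ^+ n)%R%:E * a n)%E.
  by move=> /andP[x0 _]; rewrite mule_ge0// lee_fin exprn_ge0// ltW.
have half : 0 < (2^-1 : R) < 1 by lra.
have a2 n : ((2^-1 ^+ n)%R%:E * a n <= (B * 2)%R%:E)%E.
  have -> : B * 2 = B / (1 - 2^-1) by field; lra.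
  apply: le_trans (bser _ half); rewrite -ab//.
  rewrite (nneseriesD1 (n := n))//; last by move=> *; exact: xa0.
  by rewrite leeDl// nneseries_ge0// => *; exact: xa0.
have afin n : a n \is a fin_num.
  rewrite ge0_fin_numE// ltey; apply/eqP => an; have := a2 n.
  by rewrite an gt0_muley ?lte_fin ?exprn_gt0 ?invr_gt0// leye_eq.
pose u n := fine (a n) - fine (b n).
suff u0 n : u n = 0.
  move=> n; rewrite -[a n]fineK// -[b n]fineK//; congr (_%:E).
  by apply/eqP; rewrite -subr_eq0; apply/eqP/u0.
apply: (@power_series_eq0 _ _ (B * 2 + B)) => [{}n|x x01].
  have h0 : 0 < 2^-1 ^+ n :> R by rewrite exprn_gt0// invr_gt0.
  have := a2 n; rewrite -[a n]fineK// -EFinM lee_fin.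
  rewrite -ler_pdivlMl// -exprVn invrK mulrC => an.
  have := bB n; rewrite -[b n]fineK// !lee_fin => /andP[bn0 bn].
  have := a0 n; rewrite -[a n]fineK// lee_fin => an0.
  have p1 : 1 <= 2 ^+ n :> R by rewrite exprn_ege1//; lra.
  apply: le_trans (ler_normB _ _) _; rewrite !ger0_norm// mulrDl lerD//.
  by apply: le_trans bn _; rewrite ler_peMr.
have cv (c : nat -> \bar R) : (forall n, c n \is a fin_num) -> (forall n, 0 <= c n)%E ->
    (\sum_(n <oo) (x ^+ n)%R%:E * c n = \sum_(n <oo) (x ^+ n)%R%:E * b n)%E ->
    series (fun n => fine (c n) * x ^+ n) @ \oo
      --> fine (\sum_(n <oo) (x ^+ n)%R%:E * b n)%E.
  move=> cfin c0 cb; apply: nneseries_EFin_cvg => [{}n|].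
    rewrite mulr_ge0 ?fine_ge0 ?exprn_ge0//.
    by case/andP: x01 => /ltW.
  rewrite fineK; last first.
    rewrite ge0_fin_numE; first exact: le_lt_trans (bser _ x01) (ltry _).
    apply: nneseries_ge0 => i *; rewrite mule_ge0// lee_fin exprn_ge0//.
    by case/andP: x01 => /ltW.
  rewrite -cb; apply: eq_eseriesr => i _.
  by rewrite EFinM fineK// muleC.
have := cvgB (cv a afin a0 (ab _ x01)) (cv b bfin b0 erefl).
rewrite subrr (_ : series _ - series _ = series (fun n => u n * x ^+ n)); first exact.
apply/funext => N; rewrite /series /= fctE -sumrB.
by apply: eq_bigr => i _; rewrite /u mulrBl.
Qed.

(** * Connected sums *)

Section ConnectedSums.
Variables (R : realType) (x : R).
Hypothesis x01 : 0 < x < 1.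

Definition shifted_fact (n : nat) : R := \prod_(i < n) (i.+1%:R - x).
Definition connector (m n : nat) : R := shifted_fact m * shifted_fact n / shifted_fact (m + n).

Lemma natrS_sub_gt0 (n : nat) : 0 < n.+1%:R - x.
Proof. have : 1 <= n.+1%:R :> R by rewrite ler1n.
by have := x01; lra. Qed.

Lemma shifted_fact_gt0 n : 0 < shifted_fact n.
Proof. by apply: prodr_gt0 => i _; exact: natrS_sub_gt0. Qed.

Lemma shifted_factS n : shifted_fact n.+1 = shifted_fact n * (n.+1%:R - x).
Proof. by rewrite /shifted_fact big_ord_recr. Qed.

Lemma connectorC m n : connector m n = connector n m.
Proof. by rewrite /connector addnC [shifted_fact m * _]mulrC. Qed.

Lemma connector0n n : connector 0 n = 1.
Proof.
by rewrite /connector add0n /shifted_fact big_ord0 mul1r divff// gt_eqF ?shifted_fact_gt0.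
Qed.

Lemma connector_gt0 m n : 0 < connector m n.
Proof. by rewrite !mulr_gt0 ?invr_gt0 ?shifted_fact_gt0. Qed.

(** By symmetry of the connector, this one identity moves either index. *)
Lemma connector_step m n :
  connector m n - connector m.+1 n = n%:R * (connector m.+1 n / (m.+1%:R - x)).
Proof.
rewrite /connector addSn !shifted_factS.
have := natrS_sub_gt0 m; have := natrS_sub_gt0 (m + n).
have := shifted_fact_gt0 m; have := shifted_fact_gt0 n; have := shifted_fact_gt0 (m + n).
rewrite -!natr1 natrD => *; field; rewrite !gt_eqF//=; lra.
Qed.

Lemma connector_decr m n : connector m n.+1 <= connector m n.
Proof.
rewrite -subr_ge0 connectorC [connector m n.+1]connectorC connector_step.
by rewrite mulr_ge0 ?ler0n// ltW// mulr_gt0 ?connector_gt0 ?invr_gt0 ?natrS_sub_gt0.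
Qed.

(** The connector decreases in [n], and
    [connector m 1 = (1 - x) / (m.+1%:R - x)]. *)
Lemma connector_le_harmonic m n : connector m n.+1 <= harmonic m.
Proof.
apply: (@le_trans _ _ (connector m 1)).
  elim: n => [//|n]; apply: le_trans; exact: connector_decr.
have -> : connector m 1 = (1 - x) / (m.+1%:R - x).
  rewrite /connector addn1 !shifted_factS [shifted_fact 0]big_ord0 mul1r.
  have := natrS_sub_gt0 m; have := shifted_fact_gt0 m => d m0.
  by rewrite -natr1 in m0 *; field; rewrite !gt_eqF//=; lra.
have := natrS_sub_gt0 m => m0; rewrite ler_pdivrMr// mulrC ler_pdivlMr ?ltr0Sn//.
by rewrite -natr1; have := ler0n R m; have := x01; nra.
Qed.

Lemma cvg_connector n : (fun m => connector m n.+1) @ \oo --> (0 : R).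
Proof.
apply: (squeeze_cvgr _ (cvg_cst 0) cvg_harmonic).
by apply: nearW => m; rewrite ltW ?connector_gt0//= connector_le_harmonic.
Qed.

(** [connector_step] telescopes, and the connector tends to [0]. With
    [connectorC] and [m = 0] this also expands [M^-1] as a sum over [n]. *)
Lemma sum_connector m n :
  (\sum_(M <oo) ((m < M)%:R * (connector M n.+1 / (M%:R - x)))%R%:E
     = (connector m n.+1 / n.+1%:R)%R%:E)%E.
Proof.
apply: eseries_EFin_cvg.
rewrite -(cvg_shiftn 1) /=.
have -> : (fun N => series (fun M => (m < M)%:R * (connector M n.+1 / (M%:R - x)))
     (N + 1)%N) = (fun N => (m <= N)%:R * (connector m n.+1 - connector N n.+1) / n.+1%:R).
  apply/funext => N; rewrite addn1 /series /=; elim: N => [|N IH].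
    rewrite big_nat1 ltn0 leqn0 mul0r; by case: eqP => [->|_]; rewrite ?subrr ?mulr0 !mul0r.
  rewrite big_nat_recr//= IH ltnS; case: (ltngtP m N.+1) => [|mN|->].
  - rewrite ltnS => ->; rewrite !mul1r.
    have := connector_step N n.+1 => E; have n0 : n.+1%:R != 0 :> R by rewrite pnatr_eq0.
    rewrite -[X in _ + X](mulKf n0) -E; field.
    by rewrite addrC natr1.
  - by rewrite leqNgt ltnW//= !mul0r addr0.
  - by rewrite ltnn subrr mulr0 !mul0r addr0.
have -> : connector m n.+1 / n.+1%:R = 1 * (connector m n.+1 - 0) / n.+1%:R.
  by rewrite mul1r subr0.
apply: cvgMr_tmp; apply: cvgM.
  apply: cvg_near_cst; near=> N; rewrite (_ : (m <= N)%N)//.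
  by near: N; exact: nbhs_infty_ge.
by apply: cvgB; [exact: cvg_cst|exact: cvg_connector].
Unshelve. all: by end_near.
Qed.

(** The sum of [1 / ((m_1 - x) ... (m_d - x))] over
    [0 < m_1 < ... < m_d = M]; for [d = 0] the empty sequence is taken to end
    at [0], which forces [m_1 > 0] at the next step. *)
Fixpoint strict_gf (d M : nat) : R :=
  if d is d'.+1 then (\sum_(m < M) strict_gf d' m) / (M%:R - x) else (M == 0%N)%:R.

Lemma strict_gf_ge0 d M : 0 <= strict_gf d M.
Proof.
elim: d M => [|d IH] [|M] //=; first by rewrite big_ord0 mul0r.
by rewrite divr_ge0 ?sumr_ge0// ltW// natrS_sub_gt0.
Qed.

Lemma connector_kernel_ge0 m n M : 0 <= (m < M)%:R * (connector M n / (M%:R - x)).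
Proof.
case: M => [|M]; first by rewrite ltn0 mul0r.
by rewrite mulr_ge0 ?ler0n// ltW// mulr_gt0 ?connector_gt0// invr_gt0 natrS_sub_gt0.
Qed.

(** Transport: summing out the largest index [M > m] by [sum_connector] gives
    a factor [n.+1%:R^-1] and leaves the connector at [m]. *)
Lemma sum_strict_gf_connector d n :
  (\sum_(M <oo) (strict_gf d M * connector M n.+1)%R%:E
     = (n.+1%:R^-1 ^+ d)%R%:E)%E.
Proof.
elim: d => [|d IH].
  rewrite (nneseriesD1 (n := 0%N))//; last first.
    by move=> k _; rewrite lee_fin mulr_ge0 ?strict_gf_ge0// ltW// connector_gt0.
  rewrite eseries0 ?adde0 => [|k _ /= /negbTE ->]; last by rewrite mul0r.
  by rewrite /= mul1r connector0n expr0.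
transitivity (\sum_(M <oo) \sum_(m <oo)
   (strict_gf d m)%:E * ((m < M)%:R * (connector M n.+1 / (M%:R - x)))%R%:E)%E.
  apply: eq_eseriesr => M _.
  rewrite (nneseries_split 0 M); last first.
    by move=> k _; rewrite -EFinM lee_fin mulr_ge0 ?strict_gf_ge0 ?connector_kernel_ge0.
  rewrite [X in (_ + X)%E]eseries0 ?adde0; last first.
    by move=> k; rewrite add0n leqNgt => /negbTE -> _; rewrite mul0r mule0.
  rewrite add0n big_mkord /= sumEFin -mulrA mulr_suml; congr (_%:E).
  apply: eq_bigr => m _; rewrite ltn_ord mul1r [_^-1 * _]mulrC//.
rewrite nneseries_interchange; last first.
  by move=> i j; rewrite -EFinM lee_fin mulr_ge0 ?strict_gf_ge0 ?connector_kernel_ge0.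
transitivity (\sum_(m <oo) (n.+1%:R^-1)%:E * (strict_gf d m * connector m n.+1)%R%:E)%E.
  apply: eq_eseriesr => m _.
  rewrite nneseriesZl; last by move=> M _; rewrite lee_fin connector_kernel_ge0.
  rewrite sum_connector -!EFinM; congr (_%:E).
  by rewrite mulrA mulrC.
rewrite nneseriesZl ?IH -?EFinM ?exprS// => m _.
by rewrite lee_fin mulr_ge0 ?strict_gf_ge0// ltW// connector_gt0.
Qed.

(** [M^-1] is the sum over [n] of [connector M n.+1 / (n.+1%:R - x)]; exchanging
    the sums leaves, for each [n], the sum computed by transport. *)
Lemma sum_strict_gf d :
  (\sum_(M <oo) (M%:R^-1 * strict_gf d.+1 M)%R%:E
   = \sum_(n <oo) (n.+1%:R^-1 ^+ d.+1 / (n.+1%:R - x))%R%:E)%E.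
Proof.
transitivity (\sum_(M <oo) \sum_(n <oo)
   (strict_gf d.+1 M * connector M n.+1 / (n.+1%:R - x))%R%:E)%E.
  apply: eq_eseriesr => -[|M] _.
    by rewrite invr0 mul0r eseries0// => n _ _; rewrite /= big_ord0 !mul0r.
  have := sum_connector 0 M; rewrite connector0n mul1r => E.
  rewrite mulrC EFinM -E -nneseriesZl; last first.
    by move=> n _; rewrite lee_fin connector_kernel_ge0.
  rewrite nneseries_recl//; last first.
    by move=> k _; rewrite -EFinM lee_fin mulr_ge0 ?strict_gf_ge0 ?connector_kernel_ge0.
  rewrite ltn0 mul0r mule0 add0e -nneseries_addn; last first.
    by move=> k; rewrite -EFinM lee_fin mulr_ge0 ?strict_gf_ge0 ?connector_kernel_ge0.
  by apply: eq_eseriesr => n _; rewrite addn1 mul1r connectorC -EFinM mulrA.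
rewrite nneseries_interchange; last first.
  move=> i j; rewrite lee_fin -mulrA mulr_ge0 ?strict_gf_ge0// ltW//.
  by rewrite mulr_gt0 ?connector_gt0// invr_gt0 natrS_sub_gt0.
apply: eq_eseriesr => n _.
rewrite mulrC EFinM -sum_strict_gf_connector -nneseriesZl; last first.
  by move=> M _; rewrite lee_fin mulr_ge0 ?strict_gf_ge0// ltW// connector_gt0.
by apply: eq_eseriesr => M _; rewrite -EFinM mulrC.
Qed.

End ConnectedSums.

(** * The sum formula *)

Section SumFormula.
Variable R : realType.

(** The sum of [m_1 ^- l_1 * ... * m_d ^- l_d] over [0 < m_1 < ... < m_d = M]
    and [l_1 + ... + l_d = k] with all [l_j >= 1]. The two summands are the
    cases [l_d >= 2] and [l_d = 1]. *)
Fixpoint strict_sum (d M : nat) : nat -> R :=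
  if d is d'.+1 then
    fix go k := if k is k'.+1
      then M%:R^-1 * (go k' + \sum_(m < M) strict_sum d' m k') else 0
  else fun k => ((M == 0) && (k == 0))%N%:R.

Lemma strict_sum0 M k : strict_sum 0 M k = ((M == 0) && (k == 0))%N%:R.
Proof. by []. Qed.

Lemma strict_sumS d M k : strict_sum d.+1 M k.+1 =
  M%:R^-1 * (strict_sum d.+1 M k + \sum_(m < M) strict_sum d m k).
Proof. by []. Qed.

Lemma strict_sumS0 d k : strict_sum d.+1 0 k = 0.
Proof. by case: k => [//|k]; rewrite strict_sumS invr0 mul0r. Qed.

Lemma strict_sum_ge0 d M k : 0 <= strict_sum d M k.
Proof.
elim: d M k => [|d IHd] M k; first exact: ler0n.
elim: k => [//|k IHk]; rewrite strict_sumS.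
by rewrite mulr_ge0 ?invr_ge0 ?addr_ge0 ?sumr_ge0.
Qed.

Lemma strict_sum_small d M k : (k < d)%N -> strict_sum d M k = 0.
Proof.
elim: d M k => [//|d IHd] M; elim=> [//|k IHk] kd.
rewrite strict_sumS IHk ?(ltnW kd)// big1 ?addr0 ?mulr0// => m _.
exact: IHd.
Qed.

(** Solving [M * F = x * F + H] for [F] needs [F] finite; the recurrence on
    partial sums bounds them by [H / (M - x)]. *)
Lemma series_recurrence (f h : nat -> R) (M x H : R) : 0 < x < M ->
  (forall n, 0 <= f n) -> (forall n, 0 <= h n) ->
  M * f 0%N = h 0%N -> (forall n, M * f n.+1 = x * f n + h n.+1) ->
  series h @ \oo --> H -> series f @ \oo --> H / (M - x).
Proof.
move=> /andP[x0 xM] f0 h0 fh0 fhS hH.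
have rec N : M * series f N.+1 = x * series f N + series h N.+1.
  rewrite /series /= !big_nat_recl// mulrDr fh0 [in RHS]addrCA; congr (_ + _).
  by rewrite !mulr_sumr -big_split; apply: eq_bigr => n _ /=.
have nd (u : nat -> R) : (forall n, 0 <= u n) -> nondecreasing_seq (series u).
  by move=> u0; apply/nondecreasing_seqP => n; rewrite seriesSr lerDl.
have hle N : series h N <= H.
  rewrite -(cvg_lim _ hH)//; apply: nondecreasing_cvgn_le; first exact: nd.
  exact: cvgP hH.
have cf : cvgn (series f).
  apply: nondecreasing_is_cvgn; first exact: nd.
  exists (H / (M - x)) => _ [N _ <-]; rewrite ler_pdivlMr ?subr_gt0//.
  have := rec N; have := hle N.+1; have := nd f f0 N N.+1 (leqnSn _).
  by nra.
have /cvg_ex[/= l fl] := cf.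
suff -> : H / (M - x) = l by [].
have fSl : (fun N => series f N.+1) @ \oo --> l by rewrite cvg_shiftS.
have hSH : (fun N => series h N.+1) @ \oo --> H by rewrite cvg_shiftS.
have E1 : (fun N => M * series f N.+1) @ \oo --> M * l by apply: cvgMl_tmp.
have E2 : (fun N => M * series f N.+1) @ \oo --> x * l + H.
  under eq_fun do rewrite rec.
  by apply: cvgD => //; apply: cvgMl_tmp.
have := cvg_unique _ E1 E2 => /(_ (@norm_hausdorff _ _)) E.
have -> : H = (M - x) * l by rewrite mulrBl E addrC addKr.
by rewrite mulrC mulKf// gt_eqF// subr_gt0.
Qed.

(** The recursion of [strict_sum] reads [M * F = x * F + H] for the generating
    function [F], where [H] is the sum of the generating functions of depth [d]
    at all [m < M]. *)
Lemma series_strict_sum (x : R) d M : 0 < x < 1 ->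
  series (fun e => strict_sum d M (d + e) * x ^+ e) @ \oo --> strict_gf x d M.
Proof.
move=> x01; have [x0 x1] := andP x01.
elim: d M => [|d IH] M.
  rewrite -(cvg_shiftn 1) /=; apply: cvg_near_cst; apply: nearW => N.
  rewrite addn1 /series /= big_nat_recl//= andbT mulr1 big1 ?addr0// => i _.
  by rewrite andbF mul0r.
case: M => [|M].
  apply: cvg_near_cst; apply: nearW => N.
  rewrite [strict_gf _ _ _]/= big_ord0 mul0r /series [LHS]big1// => e _.
  by rewrite strict_sumS0 mul0r.
have M0 : M.+1%:R != 0 :> R by rewrite pnatr_eq0.
apply: (@series_recurrence _
   (fun e => \sum_(m < M.+1) strict_sum d m (d + e) * x ^+ e)).
- by rewrite x0/= (lt_le_trans x1)// ler1n.
- by move=> e; rewrite mulr_ge0 ?strict_sum_ge0 ?exprn_ge0// ltW.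
- by move=> e; rewrite sumr_ge0// => m _; rewrite mulr_ge0 ?strict_sum_ge0 ?exprn_ge0// ltW.
- rewrite addn0 expr0 mulr1 strict_sumS mulVKf// strict_sum_small// add0r.
  by apply: eq_bigr => m _; rewrite addn0 mulr1.
- move=> e.
  have E : M.+1%:R * strict_sum d.+1 M.+1 (d.+1 + e).+1 =
      strict_sum d.+1 M.+1 (d.+1 + e) + \sum_(m < M.+1) strict_sum d m (d.+1 + e).
    by rewrite strict_sumS mulVKf.
  rewrite addnS mulrA E mulrDl mulr_suml addSnnS; congr (_ + _).
  by rewrite exprS mulrCA.
have -> : series (fun e => \sum_(m < M.+1) strict_sum d m (d + e) * x ^+ e) =
    (fun N => \sum_(m < M.+1) series (fun e => strict_sum d m (d + e) * x ^+ e) N).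
  by apply/funext => N; rewrite /series /= exchange_big.
by apply: cvg_big => [|m _]; [exact: add_continuous|exact: IH].
Qed.

Lemma series_inv_sqr_le N :
  \sum_(0 <= n < N.+1) (n.+1%:R^-1 ^+ 2 : R) <= 2 - N.+1%:R^-1.
Proof.
elim: N => [|N IH]; first by rewrite big_nat1 invr1; lra.
rewrite big_nat_recr//=; apply: le_trans (lerD IH (lexx _)) _.
have p : 0 < N.+1%:R :> R by rewrite ltr0n.
have q : 0 < N.+1%:R + 1 :> R by lra.
rewrite -subr_ge0 -[N.+2%:R]natr1.
rewrite [leRHS](_ : _ = (N.+1%:R * (N.+1%:R + 1) ^+ 2)^-1).
  by rewrite invr_ge0 mulr_ge0 ?exprn_ge0// ltW.
by move: p q; move: (N.+1%:R : R) => y p q; field; rewrite !gt_eqF.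
Qed.

(** The bound, uniform in [k], is what [power_series_inj] asks of one side. *)
Lemma zeta_EFin (k : nat) : (2 <= k)%N ->
  ((zeta R k)%:E = \sum_(n <oo) (n.+1%:R^-1 ^+ k)%R%:E)%E /\ zeta R k <= 2.
Proof.
move=> k2; have le2 N : series (fun n => n.+1%:R ^- k : R) N <= 2.
  apply: (@le_trans _ _ (\sum_(0 <= n < N) (n.+1%:R^-1 ^+ 2 : R))).
    apply: ler_sum => n _; rewrite -exprVn ler_wiXn2l ?invr_ge0 ?invf_le1 ?ler1n//.
  case: N => [|N]; first by rewrite big_geq.
  by apply: le_trans (series_inv_sqr_le N) _; rewrite lerBlDr lerDl invr_ge0.
have cv : cvgn (series (fun n => n.+1%:R ^- k : R)).
  apply: nondecreasing_is_cvgn.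
    by apply/nondecreasing_seqP => n; rewrite seriesSr lerDl invr_ge0 exprn_ge0.
  by exists 2 => _ [N _ <-]; exact: le2.
split; last by apply: limr_le => //; exact: nearW.
rewrite -(eseries_EFin_cvg cv); apply: eq_eseriesr => n _.
by rewrite exprVn.
Qed.

(** The two sides are the coefficients of [x ^+ e] in the two expressions
    equated by [sum_strict_gf]; the weight is [d.+2 + e] and the depth [d.+1].
    The factor [M%:R^-1] raises the last exponent by one, hence above one. *)
Theorem sum_formula d e :
  (\sum_(M <oo) (M%:R^-1 * strict_sum d.+1 M (d.+1 + e))%R%:E
     = (zeta R (d.+2 + e))%:E)%E.
Proof.
move: e.
apply: (@power_series_inj _ _ _ 2) => [e|e|x x01].
- by apply: nneseries_ge0 => M _ _; rewrite lee_fin mulr_ge0 ?invr_ge0 ?strict_sum_ge0.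
- have [E z2] := @zeta_EFin (d.+2 + e) isT; rewrite !lee_fin z2 andbT -lee_fin E.
  by apply: nneseries_ge0 => n *; rewrite lee_fin exprn_ge0 ?invr_ge0.
have [x0 x1] := andP x01.
have xn0 n : 0 <= x ^+ n by rewrite exprn_ge0// ltW.
transitivity (\sum_(M <oo) (M%:R^-1 * strict_gf x d.+1 M)%R%:E)%E.
  transitivity (\sum_(e <oo) \sum_(M <oo)
      (x ^+ e * (M%:R^-1 * strict_sum d.+1 M (d.+1 + e)))%R%:E)%E.
    apply: eq_eseriesr => e _; rewrite -nneseriesZl// => M _.
    by rewrite lee_fin mulr_ge0 ?invr_ge0 ?strict_sum_ge0.
  rewrite nneseries_interchange; last first.
    move=> e M; rewrite lee_fin mulr_ge0// mulr_ge0 ?invr_ge0 ?ler0n//.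
    exact: strict_sum_ge0.
  apply: eq_eseriesr => M _; apply: eseries_EFin_cvg.
  have -> : series (fun e => x ^+ e * (M%:R^-1 * strict_sum d.+1 M (d.+1 + e))) =
     (fun N => M%:R^-1 * series (fun e => strict_sum d.+1 M (d.+1 + e) * x ^+ e) N).
    apply/funext => N; rewrite /series /= mulr_sumr; apply: eq_bigr => e _.
    by rewrite mulrC -mulrA.
  by apply: cvgMl_tmp; exact: series_strict_sum.
rewrite sum_strict_gf//.
transitivity (\sum_(e <oo) \sum_(n <oo) (x ^+ e * n.+1%:R^-1 ^+ (d.+2 + e))%R%:E)%E;
  last first.
  apply: eq_eseriesr => e _; rewrite (@zeta_EFin (d.+2 + e) isT).1 -nneseriesZl.
    by apply: eq_eseriesr => n _; rewrite EFinM.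
  by move=> n _; rewrite lee_fin exprn_ge0 ?invr_ge0.
rewrite nneseries_interchange; last by move=> e n; rewrite lee_fin mulr_ge0// exprn_ge0.
apply: eq_eseriesr => n _; apply/esym/eseries_EFin_cvg.
have n0 : n.+1%:R != 0 :> R by rewrite pnatr_eq0.
have n1 : 1 <= n.+1%:R :> R by rewrite ler1n.
have xn : `|x / n.+1%:R| < 1.
  rewrite ger0_norm ?divr_ge0 ?ler0n// ?(ltW x0)//.
  by rewrite ltr_pdivrMr ?ltr0n// mul1r; exact: lt_le_trans x1 n1.
have := @cvg_geometric_series _ (n.+1%:R^-1 ^+ d.+2) _ xn.
have -> : n.+1%:R^-1 ^+ d.+2 * (1 - x / n.+1%:R)^-1 = n.+1%:R^-1 ^+ d.+1 / (n.+1%:R - x).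
  rewrite [_ ^+ d.+2]exprSr -mulrA -invfM mulrBr mulr1 mulrCA divff// mulr1.
  by [].
rewrite (_ : geometric _ _ = (fun e => x ^+ e * n.+1%:R^-1 ^+ (d.+2 + e)))//.
by apply/funext => e /=; rewrite exprD exprMn mulrCA.
Qed.

End SumFormula.

Arguments strict_sum : simpl never.

(** * Sums over the exponents *)

Section Exponents.
Variable R : realType.

(** The terms of degree 1 to [N] of the geometric series in [u *: 'X]. The
    bound [N] comes from the bounded exponents; it does not affect coefficients
    of degree at most [N]. *)
Definition trunc_geom (N : nat) (u : R) : {poly R} :=
  \sum_(1 <= e < N.+1) u ^+ e *: 'X^e.

Lemma trunc_geomE N u :
  trunc_geom N u + u ^+ N.+1 *: 'X^(N.+1) = u *: 'X * (1 + trunc_geom N u).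
Proof.
rewrite /trunc_geom; elim: N => [|N IH].
  by rewrite big_geq// add0r addr0 mulr1.
rewrite [in LHS]big_nat_recr//= IH [in RHS]big_nat_recr//= addrA [in RHS]mulrDr.
congr (_ + _); by rewrite -scalerAl -scalerAr scalerA -!exprS.
Qed.

Lemma trunc_geom0 N u : (trunc_geom N u)`_0 = 0.
Proof.
rewrite /trunc_geom coef_sum big_nat big1// => -[|e]//= _.
by rewrite coefZ coefXn mulr0.
Qed.

(** Below the truncation, [trunc_geom N u] equals
    [u *: 'X * (1 + trunc_geom N u)]. *)
Lemma coef_trunc_geomM N u (A : {poly R}) k : (k < N)%N ->
  (trunc_geom N u * A)`_k.+1 = u * ((trunc_geom N u * A)`_k + A`_k).
Proof.
move=> kN; have := congr1 (fun p => (p * A)`_k.+1) (trunc_geomE N u).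
rewrite mulrDl coefD -scalerAl coefZ coefXnM ltnS kN mulr0 addr0 => ->.
by rewrite -mulrA -scalerAl coefZ coefXM /= mulrDl mul1r coefD [A`_k + _]addrC.
Qed.

(** Lowering the last exponent by one costs the factor [u ord_max] and turns
    the conditions on the exponents into [ks j >= 1] for all [j]; the
    compositions of [k.-1] are then collected by a product of polynomials. *)
Lemma sum_admissible (r k : nat) (u : 'I_r.+1 -> R) : (0 < k)%N ->
  \sum_(ks : {ffun 'I_r.+1 -> 'I_k.+1} | admissible ks) \prod_(j < r.+1) u j ^+ ks j =
  u ord_max * (\prod_(j < r.+1) trunc_geom k (u j))`_k.-1.
Proof.
move=> k0.
pose lo (j : 'I_r.+1) := if j.+1 == r.+1 then 2%N else 1%N.
pose g (j : 'I_r.+1) : {poly R} := \sum_(e < k.+1 | (lo j <= e)%N) u j ^+ e *: 'X^e.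
transitivity (\prod_j g j)`_k.
  rewrite /g bigA_distr_big_dep coef_sum.
  rewrite [in RHS](bigID (fun f : {ffun 'I_r.+1 -> 'I_k.+1} => \sum_j f j == k)%N)/=.
  have E (f : {ffun 'I_r.+1 -> 'I_k.+1}) : (\prod_j (u j ^+ f j *: 'X^(f j)))`_k =
      (\prod_j u j ^+ f j) * (k == (\sum_j f j)%N)%:R.
    by rewrite scaler_prod prodrXr coefZ coefXn.
  rewrite [X in _ = _ + X]big1 ?addr0 => [|f /andP[_ fk]]; last first.
    by rewrite E eq_sym (negbTE fk) mulr0.
  apply: eq_big => [f|f /andP[/eqP fk _]]; last by rewrite E fk eqxx mulr1.
  rewrite /admissible andbC; congr andb.
  apply/forallP/familyP => H j; have := H j; rewrite /lo unfold_in /=.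
    by case: ifP.
  by case: ifP.
have gS (j : 'I_r.+1) : j != ord_max -> g j = trunc_geom k (u j).
  move=> jr; rewrite /g /lo eqSS ifN; first by rewrite /trunc_geom big_geq_mkord.
  by apply: contra jr => /eqP jr; apply/eqP/val_inj.
have gmax : g ord_max + u ord_max ^+ k.+1 *: 'X^(k.+1) =
    u ord_max *: 'X * trunc_geom k (u ord_max).
  have -> : g ord_max = \sum_(2 <= e < k.+1) u ord_max ^+ e *: 'X^e.
    by rewrite big_geq_mkord /g /lo eqxx.
  rewrite -big_nat_recr//= /trunc_geom big_add1 mulr_sumr; apply: eq_bigr => e _.
  by rewrite -scalerAl -scalerAr scalerA -!exprS.
rewrite !big_ord_recr /=.
rewrite (eq_bigr (fun j => trunc_geom k (u (widen_ord (leqnSn r) j)))); last first.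
  by move=> j _; rewrite gS// -val_eqE/= ltn_eqF.
set P := \prod_(_ < r) _.
have -> : g ord_max = u ord_max *: ('X * trunc_geom k (u ord_max))
    - u ord_max ^+ k.+1 *: 'X^(k.+1) by rewrite scalerAl -gmax addrK.
rewrite mulrBr coefB -!scalerAr !coefZ coefMXn ltnS leqnn mulr0 subr0.
by rewrite mulrCA coefXM; case: (k) k0.
Qed.

End Exponents.

(** * Merging equal letters *)

Section Merging.
Variable R : realType.

(** Half the sum over the Q-words of length [r.+1] that end at absolute value [M],
    after merging: a sequence of [d.+1] distinct values and exponents of sum [k]
    comes from ['C(k - d - 1, r - d)] choices of blocks and exponents. *)
Definition merged_sum (r M k : nat) : R :=
  \sum_(d < r.+1) 2 ^+ d * 'C(k - d - 1, r - d)%:R * strict_sum R d.+1 M k.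

Lemma merged_sum0 M k : merged_sum 0 M k = strict_sum R 1 M k.
Proof. by rewrite /merged_sum big_ord_recl big_ord0 addr0 sub0n bin0 !mul1r. Qed.

(** The recursion satisfied by the sum over words: the last exponent is at
    least two, or it is one and the last letter extends a word that ends at [M]
    in one way, or a word that ends below [M] in two ways. Terms with [k <= d],
    where the truncated differences break Pascal's rule, vanish. *)
Lemma merged_sum_rec r M k :
  merged_sum r.+1 M k.+1 =
  M%:R^-1 * (merged_sum r.+1 M k + (merged_sum r M k + 2 * \sum_(m < M) merged_sum r m k)).
Proof.
rewrite {1}/merged_sum; under eq_bigr do rewrite strict_sumS mulrCA mulrDr.
rewrite -mulr_sumr big_split/= addrA; congr (_ * (_ + _)).
  rewrite /merged_sum [in RHS]big_ord_recr [in LHS]big_ord_recr /= addrAC subnn !bin0.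
  rewrite -big_split/=; congr (_ + _); apply: eq_bigr => d _; rewrite -mulrDl -mulrDr -natrD.
  have [dk|kd] := ltnP d k; last by rewrite strict_sum_small ?ltnS// !mulr0.
  have dr : (d <= r)%N by rewrite -ltnS.
  by rewrite (subSn dr) (_ : k.+1 - d - 1 = (k - d - 1).+1)%N ?binS//; lia.
rewrite big_ord_recl [X in X + _](_ : _ = 0) ?add0r; last first.
  case: k => [|k]; first by rewrite !subn0 subn1 bin0n mulr0 mul0r.
  by rewrite big1 ?mulr0// => m _; rewrite strict_sum0 andbF.
rewrite /merged_sum exchange_big mulr_sumr; apply: eq_bigr => d _ /=.
rewrite -mulr_sumr exprS !mulrA; congr (_ * _ * _); congr ('C(_, _)%:R).
Qed.

End Merging.

(** * Words *)

Section Words.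
Local Open Scope nat_scope.

(** Both the order condition and the multiplicity condition on primed letters
    are conditions on neighbours: a primed letter must exceed its predecessor
    strictly. *)
Definition may_follow (a c : letter) : bool :=
  (absl a < absl c) || ((absl a == absl c) && c.2).

Definition Qvalid (s : seq letter) : bool :=
  all (fun a => 0 < absl a) s && sorted may_follow s.

Definition valid (primed_start : bool) (s : seq letter) : bool :=
  Qvalid s && (primed_start || (head (unprimed 0) s).2).

Lemma may_followE a c : may_follow a c = if c.2 then (a <= c)%O else (a < c)%O.
Proof.
case: a c => [m a] [n c]; rewrite /may_follow /absl /=.
rewrite lexi_pair ltxi_pair !leEnat; case: a; case: c => /=; case: ltngtP => //=.
Qed.

Lemma may_follow_trans : transitive may_follow.
Proof.
move=> [n b] [m a] [p c]; rewrite /may_follow /absl /=.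
by case: a; case: b; case: c => /=; lia.
Qed.

Lemma may_follow_primed i : may_follow (primed i) (primed i) = false.
Proof. by rewrite /may_follow ltnn andbF. Qed.

(** Equal letters of a sorted word are adjacent, so that a repeated primed letter
    shows up as two equal neighbours. *)
Lemma sorted_may_followP s : reflect
  (sorted <=%O s /\ forall i, count_mem (primed i) s <= 1) (sorted may_follow s).
Proof.
apply: (iffP idP) => [ms|[]].
  split; first by apply: sub_sorted ms => a c; rewrite may_followE; case: ifP => // _ /ltW.
  move=> i; move: ms; rewrite (sorted_pairwise may_follow_trans).
  elim: s => //= x s IH /andP[/allP xs /IH]; case: eqP => // xi _.
  suff -> : count_mem (primed i) s = 0 by [].
  by apply/count_memPn/negP => /xs; rewrite xi may_follow_primed.
elim: s => //= x [//|y s] IH /= /andP[xy ys] cnt; apply/andP; split.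
  rewrite may_followE; case: ifP => // y2; rewrite lt_neqAle xy andbT.
  apply/eqP => xE; have := cnt (absl y); rewrite xE.
  by case: (y) y2 => n b /= ->; rewrite eqxx.
by apply: IH => // i; apply: leq_trans (cnt i); rewrite leq_addl.
Qed.

(** The words of length [r.+1] whose last letter has absolute value [M], grouped
    by whether the previous letter also has absolute value [M]; the flag allows
    the first letter to be primed. *)
Fixpoint words (primed_start : bool) (r M : nat) : seq (seq letter) :=
  if r is r'.+1 then
    [seq rcons w (unprimed M) | w <- words primed_start r' M] ++
    [seq rcons w c | w <- flatten [seq words primed_start r' m | m <- iota 0 M],
                     c <- [:: primed M; unprimed M]]
  else if M == 0 then [::]
  else [:: unprimed M] :: (if primed_start then [:: [:: primed M]] else [::]).

Lemma wordsS b r M : words b r.+1 M =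
  [seq rcons w (unprimed M) | w <- words b r M] ++
  [seq rcons w c | w <- flatten [seq words b r m | m <- iota 0 M],
                   c <- [:: primed M; unprimed M]].
Proof. by []. Qed.

Lemma valid_rcons b s c : s != [::] ->
  valid b (rcons s c) =
  [&& 0 < absl c, valid b s & may_follow (last (unprimed 0) s) c].
Proof.
case: s => [//|x s] _; rewrite /valid /Qvalid /= rcons_path all_rcons.
case: (0 < absl c); case: (0 < absl x); case: (all _ s); case: (path _ _ _) => //=.
exact: andbC.
Qed.

Lemma valid_last_gt0 b s : s != [::] -> valid b s -> 0 < absl (last (unprimed 0) s).
Proof.
case: s => [//|x s] _ /andP[/andP[/allP sp _] _].
by apply: sp; rewrite /= mem_last.
Qed.

Lemma mem_words b r M s :
  (s \in words b r M) =
  [&& size s == r.+1, valid b s & absl (last (unprimed 0) s) == M].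
Proof.
elim: r M s => [|r IH] M s.
  case: s => [|a [|a' s]] /=; first by case: M b => [|M] [].
    rewrite /valid /Qvalid /= /absl; case: a => [n c] /=; case: M => [|M] /=.
      by rewrite in_nil; case: n => [|n]; rewrite ?andbF.
    have E d : ((n, c) == (M.+1, d) :> letter) = (n == M.+1) && (c == d) by [].
    by case: b; rewrite !inE ?eqseq_cons !E /= ?andbT;
       case: n {E} => [|n]; case: c; rewrite ?andbT ?andbF ?orbF ?orbT.
  by case: M => [|M] //; case: b; rewrite !inE !eqseq_cons /= !andbF.
case/lastP: s => [|s c].
  rewrite wordsS mem_cat; apply/negbTE/negP.
  by case/orP => [/mapP[w _]|/allpairsP[p [_ _]]] /(congr1 size); rewrite size_rcons.
have [->|s0] := eqVneq s [::].
  rewrite wordsS mem_cat; apply/negbTE/negP => /orP[/mapP[w]|/allpairsP[[w d] /= []]].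
    by rewrite IH; case: w => [|x [|y w]].
  by move=> /flatten_mapP[m _]; rewrite IH; case: w => [|x [|y w]].
rewrite size_rcons eqSS valid_rcons// last_rcons wordsS mem_cat; apply/idP/idP.
  case/orP => [/mapP[w]|/allpairsP[[w d] /= []]].
    rewrite IH => /and3P[ws wv /eqP wM] /rcons_inj[-> ->].
    have := valid_last_gt0 _ wv; rewrite wM -size_eq0 (eqP ws) => /(_ isT) M0.
    by rewrite wv /may_follow wM /= M0 !eqxx orbT.
  move=> /flatten_mapP[m]; rewrite mem_iota IH => /= mM /and3P[ws wv /eqP wm] dM.
  move=> /rcons_inj[-> ->].
  have {}dM : absl d = M by move: dM; rewrite !inE => /orP[] /eqP ->.
  by rewrite ws wv /may_follow wm dM mM eqxx (leq_trans _ mM).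
case/and3P => ss /and3P[c0 sv sc] /eqP cM; apply/orP.
case/orP: sc => [sc|/andP[/eqP sc c2]]; [right|left].
  apply: allpairs_f.
    apply/flatten_mapP; exists (absl (last (unprimed 0) s)).
      by rewrite mem_iota add0n -cM.
    by rewrite IH ss sv eqxx.
  by rewrite -cM !inE; case: (c) => n [] /=; rewrite eqxx ?orbT.
apply/mapP; exists s; first by rewrite IH ss sv sc cM eqxx.
by congr rcons; move: cM c2; case: (c) => n d /= <- ->.
Qed.

Lemma uniq_words b r M : uniq (words b r M).
Proof.
elim: r M => [|r IH] M.
  by case: M => [|M] //; case: b; rewrite //= inE /= andbT; apply/eqP => -[].
rewrite wordsS cat_uniq map_inj_uniq ?IH; last exact: rcons_injl.
have lastW m w : w \in words b r m -> absl (last (unprimed 0) w) = m.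
  by rewrite mem_words => /and3P[_ _ /eqP].
rewrite andTb; apply/andP; split.
  apply/hasPn => s /allpairsP[[w d] /= [/flatten_mapP[m]]].
  rewrite mem_iota => /= mM wm _ ->; apply/negP => /mapP[w' wM /rcons_inj[E _]].
  by move: mM; rewrite -(lastW _ _ wm) E (lastW _ _ wM) ltnn.
apply: allpairs_uniq; last by move=> [w d] [w' d'] _ _ /= /rcons_inj[-> ->].
  2: by rewrite /= inE andbT; apply/eqP => -[].
elim: M => [//|M IHM]; rewrite -addn1 iotaD map_cat flatten_cat cat_uniq IHM /=.
rewrite cats0 IH andbT; apply/hasPn => w wM; apply/negP => /flatten_mapP[m].
rewrite mem_iota add0n => /= mM /lastW; rewrite (lastW _ _ wM) => E.
by move: mM; rewrite -E add0n ltnn.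
Qed.

End Words.

(** * Sums over words *)

Section WordSums.
Variable R : realType.

Lemma Qword_valid r (m : r.+1.-tuple letter) : Qword m <-> valid true m.
Proof.
rewrite /valid orTb andbT; split.
  move=> [pos srt cnt]; apply/andP; split; last exact/sorted_may_followP.
  by apply/allP => a /tnthP[j ->].
move=> /andP[/allP pos /sorted_may_followP[srt cnt]]; split=> // j.
by apply: pos; rewrite mem_tnth.
Qed.

Lemma Pword_valid r (m : r.+1.-tuple letter) : Pword m <-> valid false m.
Proof.
have hd : head (unprimed 0) m = tnth m ord0 by rewrite (tnth_nth (unprimed 0)) nth0.
rewrite /valid orFb hd; split.
  move=> [/Qword_valid /andP[-> _] first]; rewrite andTb.
  by rewrite (first ord0).
move=> /andP[v h]; split; first by apply/Qword_valid; rewrite /valid v.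
by move=> j j0; have -> : j = ord0 by [apply: val_inj]; case: (tnth _ _) h => n [].
Qed.

(** Each word is listed once, under the absolute value of its last letter. *)
Lemma esum_words b r (F : seq letter -> R) : (forall s, 0 <= F s) ->
  (\esum_(m in [set m : r.+1.-tuple letter | valid b m]) (F m)%:E
     = \sum_(M <oo) (\sum_(s <- words b r M) F s)%R%:E)%E.
Proof.
move=> F0.
transitivity (\esum_(s in \bigcup_M [set` words b r M]) (F s)%:E)%E.
  rewrite (reindex_esum [set m : r.+1.-tuple letter | valid b m] _ val)//; split.
  - move=> m /= mv; exists (absl (last (unprimed 0) m)) => //=.
    by rewrite mem_words size_tuple mv !eqxx.
  - by move=> m m' _ _ /val_inj.
  - move=> s [M _] /=; rewrite mem_words => /and3P[sz sv _].
    by exists (Tuple sz).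
rewrite nneseries_sum_bigcup//; last first.
  move=> M M' _ _ [s []] /=; rewrite !mem_words.
  by move=> /and3P[_ _ /eqP <-] /and3P[_ _ /eqP <-].
apply: eq_eseriesr => M _; rewrite esum_fset; last 2 first.
- exact: finite_seq.
- by move=> s _; rewrite lee_fin.
by rewrite -sumEFin [in RHS]fsbig_seq ?uniq_words.
Qed.

(** The coefficient of degree [k <= N] is the sum, over all positive exponents
    of sum [k], of the term that the word contributes. *)
Definition word_poly (N : nat) (s : seq letter) : {poly R} :=
  \prod_(a <- s) trunc_geom N (absl a)%:R^-1.

Lemma sum_word_polyS N b r M :
  \sum_(s <- words b r.+1 M) word_poly N s =
  trunc_geom N M%:R^-1 * (\sum_(s <- words b r M) word_poly N s
    + 2 * \sum_(m < M) \sum_(s <- words b r m) word_poly N s).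
Proof.
have E s c : word_poly N (rcons s c) = trunc_geom N (absl c)%:R^-1 * word_poly N s.
  by rewrite /word_poly big_rcons mulrC.
rewrite wordsS big_cat big_map mulrDr mulr_sumr; congr (_ + _).
  by apply: eq_bigr => s _; rewrite E.
rewrite big_allpairs_dep big_flatten big_map -[M in iota 0 M]subn0 big_mkord.
rewrite mulrCA !mulr_sumr; apply: eq_bigr => m _; rewrite !mulr_sumr.
apply: eq_bigr => s _; rewrite !big_cons big_nil !E Monoid.mulm1.
by rewrite mulr_natl mulr2n.
Qed.

(** Both sides obey the recursion of [merged_sum_rec]; for one letter and
    [M, k > 0] they are [(1 + b)%:R * M ^- k], the flag [b] allowing the letter to
    be primed. *)
Lemma coef_sum_word_poly N b r M k : (k <= N)%N ->
  (\sum_(s <- words b r M) word_poly N s)`_k = (1 + b)%:R * merged_sum R r M k.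
Proof.
have gE u (A : {poly R}) : (trunc_geom N u * A)`_0 = 0.
  by rewrite coef0M trunc_geom0 mul0r.
have m0 r' M' : merged_sum R r' M' 0 = 0 by rewrite /merged_sum big1// => d _; rewrite mulr0.
elim: r M k => [|r IH] M k kN.
  have -> : \sum_(s <- words b 0 M) word_poly N s =
      trunc_geom N M%:R^-1 * (((0 < M) * (1 + b))%N%:R)%:P.
    rewrite polyC_natr mulr_natr; case: M => [|M]; first by rewrite big_nil mulr0n.
    by case: b; rewrite /word_poly !big_cons !big_nil !mulr1 addr0 ?mulr2n.
  elim: k kN => [|k IHk] kN; first by rewrite gE m0 mulr0.
  rewrite coef_trunc_geomM// IHk ?(ltnW kN)// !merged_sum0.
  rewrite strict_sumS coefC mulrCA; congr (_ * _).
  rewrite mulrDr; congr (_ + _).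
  clear IHk; case: M => [|M]; first by rewrite big_ord0 mulr0 mul0n; case: ifP.
  rewrite big_ord_recl big1 ?addr0 => [|m _]; rewrite strict_sum0//.
  by case: ifP => _; rewrite ?mulr1 ?mulr0 ?mul1n.
elim: k kN => [|k IHk] kN.
  by rewrite sum_word_polyS gE m0 mulr0.
rewrite sum_word_polyS coef_trunc_geomM// -sum_word_polyS IHk ?(ltnW kN)// merged_sum_rec.
rewrite coefD IH ?(ltnW kN)// [2 * \sum_(m < M) \sum_(_ <- _) _]mulr_natl coefMn coef_sum.
under eq_bigr do rewrite IH ?(ltnW kN)//.
rewrite -mulr_sumr; ring.
Qed.

End WordSums.

(** * Sums over words and exponents *)

Section Admissible.
Variable R : realType.

Lemma trunc_geom_coef_ge0 N (u : R) k : 0 <= u -> 0 <= (trunc_geom N u)`_k.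
Proof.
move=> u0; rewrite /trunc_geom coef_sum sumr_ge0// => e _.
by rewrite coefZ coefXn mulr_ge0 ?exprn_ge0.
Qed.

Lemma word_poly_coef_ge0 N s k : 0 <= (word_poly R N s)`_k.
Proof.
rewrite /word_poly; elim: s k => [|a s IH] k; first by rewrite big_nil coef1.
rewrite big_cons coefM sumr_ge0// => i _.
by rewrite mulr_ge0// trunc_geom_coef_ge0// invr_ge0.
Qed.

(** The case [b = true] is Q and [b = false] is P: the two differ by the factor
    [1 + b] contributed by the first letter. *)
Lemma sum_words_admissible b r k : (r.+1 < k)%N ->
  (\sum_(ks : {ffun 'I_r.+1 -> 'I_k.+1} | admissible ks)
     \esum_(m in [set m : r.+1.-tuple letter | valid b m])
       (\prod_(j < r.+1) (absl (tnth m j))%:R ^- ks j)%:E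
   = ((1 + b)%:R * \sum_(d < r.+1) 2 ^+ d * 'C(k - d - 2, r - d)%:R * zeta R k)%:E)%E.
Proof.
move=> rk; have k0 : (0 < k)%N by apply: leq_ltn_trans rk.
pose F s : R := (absl (last (unprimed 0) s))%:R^-1 * (word_poly R k s)`_k.-1.
have F0 s : 0 <= F s by rewrite mulr_ge0 ?invr_ge0// word_poly_coef_ge0.
rewrite -esum_sum; last first.
  by move=> m ks _ _; rewrite lee_fin prodr_ge0// => j _; rewrite invr_ge0 exprn_ge0.
transitivity (\esum_(m in [set m : r.+1.-tuple letter | valid b m]) (F m)%:E)%E.
  apply: eq_esum => m _; rewrite sumEFin; congr (_%:E).
  under eq_bigr do under eq_bigr do rewrite -exprVn.
  rewrite (sum_admissible (fun j => (absl (tnth m j))%:R^-1))// /F; congr (_ * _`__).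
    by rewrite (last_nth (unprimed 0)) (tnth_nth (unprimed 0)) size_tuple; case/tupleP: m.
  by rewrite /word_poly big_tuple.
rewrite esum_words//.
transitivity (\sum_(M <oo) \sum_(d < r.+1)
   ((1 + b)%:R * (2 ^+ d * 'C(k - d - 2, r - d)%:R))%R%:E
     * (M%:R^-1 * strict_sum R d.+1 M k.-1)%R%:E)%E.
  apply: eq_eseriesr => M _; rewrite sumEFin; congr (_%:E).
  transitivity (M%:R^-1 * ((1 + b)%:R * merged_sum R r M k.-1)).
    rewrite -(@coef_sum_word_poly _ k b r M k.-1) ?leq_pred// coef_sum mulr_sumr.
    rewrite [LHS]big_seq [RHS]big_seq; apply: eq_bigr => s.
    by rewrite mem_words /F => /and3P[_ _ /eqP ->].
  rewrite /merged_sum !mulr_sumr; apply: eq_bigr => d _.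
  rewrite (_ : k.-1 - d - 1 = k - d - 2)%N; last by lia.
  by ring.
rewrite nneseries_sum; last first.
  move=> d M _; rewrite -EFinM lee_fin !mulr_ge0 ?exprn_ge0 ?invr_ge0//.
  exact: strict_sum_ge0.
rewrite mulr_sumr -sumEFin; apply: eq_bigr => d _.
rewrite nneseriesZl; last first.
  by move=> M _; rewrite lee_fin mulr_ge0 ?invr_ge0// strict_sum_ge0.
have dr := ltn_ord d.
have -> : k.-1 = (d.+1 + (k - d - 2))%N by lia.
have kE : (d.+2 + (k - d - 2) = k)%N by lia.
by rewrite sum_formula kE -EFinM !mulrA.
Qed.

End Admissible.

Theorem theorem6p2 (R : realType) (k r : nat) (hr : (0 < r)%N) (hkr : (r < k)%N) :
  (\sum_(ks : {ffun 'I_r -> 'I_k.+1} | admissible ks)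
      zetaQ R (fun j => ks j : nat))%E
    = ((\sum_(1 <= i < r.+1) 2 ^+ i * ('C(k - i - 1, r - i))%:R * zeta R k)%:E)%E
  /\
  (\sum_(ks : {ffun 'I_r -> 'I_k.+1} | admissible ks)
      zetaP R (fun j => ks j : nat))%E
    = ((\sum_(1 <= i < r.+1) 2 ^+ (i - 1) * ('C(k - i - 1, r - i))%:R * zeta R k)%:E)%E.
Proof.
case: r hr hkr => [//|r] _ rk.
have setQ : @Qword r.+1 = [set m : r.+1.-tuple letter | valid true m].
  by apply/seteqP; split=> m /Qword_valid.
have setP : @Pword r.+1 = [set m : r.+1.-tuple letter | valid false m].
  by apply/seteqP; split=> m /Pword_valid.
split.
  rewrite /zetaQ setQ sum_words_admissible// mulr_sumr big_add1 big_mkord.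
  congr (_%:E); apply: eq_bigr => d _; rewrite exprS !mulrA subSS.
  by rewrite (_ : k - d.+1 - 1 = k - d - 2)%N//; lia.
rewrite /zetaP setP sum_words_admissible// mul1r big_add1 big_mkord.
congr (_%:E); apply: eq_bigr => d _.
by have -> : (k - d.+1 - 1 = k - d - 2)%N by [lia]; rewrite !subSS subn0.
Qed.
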